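(* Let $d\ge1$ and let $\mathcal V_{d,1}\subset\mathbb P(S^dV)\cong\mathbb P^d_{\mathbb C}$ ($\dim V=2$) be the rational normal curve parametrized by $[x_0:x_1]\mapsto[x_0^d:x_0^{d-1}x_1:\cdots:x_0x_1^{d-1}:x_1^d]$. Then the set of values of $\Phi_{\mathcal V_{d,1}}(Q)=\mathrm{EDdegree}_Q(\mathcal V_{d,1})$, as $Q$ ranges over the set $S_+^2(S^dV^{\mathbb R})$ of all inner products on $S^dV^{\mathbb R}\cong\mathbb R^{d+1}$, is $$\Phi_{\mathcal V_{d,1}}(S_+^2(S^dV^{\mathbb R}))=\{d,d+2,\dots,3d-2\}.$$ In particular, $\min_{Q\in S_+^2(S^dV^{\mathbb R})}\Phi_{\mathcal V_{d,1}}(Q)=d$.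
   Context: An inner product is a positive definite symmetric bilinear form $Q$, extended complex bilinearly to $W=\mathbb C^{d+1}\cong S^dV$; $q(x)=Q(x,x)$. For a projective variety $X\subset\mathbb P(W)$ with affine cone $CX\subset W$, $\mathrm{EDdegree}_Q(X)$ is the number, for a general $u\in W$, of points $x\in(CX)_{\mathrm{sm}}$ with $Q(u-x,v)=0$ for all $v\in T_xCX$, i.e. of complex critical points of $x\mapsto q(u-x)$ on $(CX)_{\mathrm{sm}}$. *)

(* Defs.v *)
From HB Require Import structures.
From mathcomp Require Import all_boot all_order all_algebra.
From mathcomp Require Import sesquilinear.
From mathcomp Require Import complex.
From mathcomp Require Import boolp classical_sets cardinality reals.
From mathcomp Require Import mpoly.

Set Implicit Arguments.
Unset Strict Implicit.
Unset Printing Implicit Defensive.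

Import Order.TTheory GRing.Theory Num.Theory.

Local Open Scope classical_set_scope.
Local Open Scope card_scope.
Local Open Scope ring_scope.

Section AffineVarieties.
Variables (K : fieldType) (n : nat).
Implicit Types (Y : set 'rV[K]_n) (x v : 'rV[K]_n).

Definition vanishing_ideal Y : set {mpoly K[n]} :=
  [set f | forall x, Y x -> f.@[x 0] = 0].

Definition tangent_space Y x : set 'rV[K]_n :=
  [set v | forall f, vanishing_ideal Y f ->
             \sum_(i < n) (f^`M(i)).@[x 0] * v 0 i = 0].

(* The classes of the f_i in the coordinate ring K[Y] are algebraically
   independent over K. *)
Definition alg_independent Y (k : nat) (f : k.-tuple {mpoly K[n]}) : Prop :=
  forall P : {mpoly K[k]}, vanishing_ideal Y (P \mPo f) -> P = 0.

(* The dimension of Y as the transcendence degree of its function field: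
   when Y is irreducible, a transcendence basis of K(Y) can be chosen in K[Y]. *)
Definition has_dimension Y (k : nat) : Prop :=
  (exists f : k.-tuple {mpoly K[n]}, alg_independent Y f) /\
  (forall (m : nat) (f : m.-tuple {mpoly K[n]}),
      alg_independent Y f -> (m <= k)%N).

(* Nonsingular points of an irreducible Y: dim T_x Y = dim Y. *)
Definition smooth_locus Y : set 'rV[K]_n :=
  [set x | Y x /\ exists V : {vspace 'rV[K]_n},
             [set` V] = tangent_space Y x /\ has_dimension Y (\dim V)].

(* P holds on a nonempty Zariski open subset of K^n. *)
Definition for_general (P : 'rV[K]_n -> Prop) : Prop :=
  exists2 f : {mpoly K[n]}, f != 0 & forall u : 'rV[K]_n, f.@[u 0] != 0 -> P u.

End AffineVarieties.

(* A point of P(W) is a line of W, i.e. a one-dimensional subspace. *)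
Definition affine_cone (K : fieldType) (W : vectType K) (X : set {vspace W}) :
  set W := [set w | exists2 L, X L & w \in L].

Section EDDegree.
Variables (R : realType) (n : nat).

Definition complex_extension (Q : {dot 'rV[R]_n for idfun}) :
  'rV[R[i]]_n -> 'rV[R[i]]_n -> R[i] :=
  form_of_matrix idfun (map_mx (real_complex R) (matrix_of_form Q)).

Definition ED_critical_points (Q : {dot 'rV[R]_n for idfun})
    (X : set {vspace 'rV[R[i]]_n}) (u : 'rV[R[i]]_n) : set 'rV[R[i]]_n :=
  [set x | smooth_locus (affine_cone X) x /\
     forall v, tangent_space (affine_cone X) x v ->
               complex_extension Q (u - x) v = 0].

(* The default value 0 is taken only if there is no generic number of critical
   points; otherwise this number is unique. *)
Definition EDdegree (Q : {dot 'rV[R]_n for idfun})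
    (X : set {vspace 'rV[R[i]]_n}) : nat :=
  xget 0%N [set m | for_general (fun u => ED_critical_points Q X u #= `I_m)].

End EDDegree.

Definition veronese (K : fieldType) (d : nat) (a b : K) : 'rV[K]_d.+1 :=
  \row_(i < d.+1) (a ^+ (d - i) * b ^+ i).

Definition rational_normal_curve (K : fieldType) (d : nat) :
  set {vspace 'rV[K]_d.+1} :=
  [set L | exists a b : K, (a, b) != (0, 0) /\ L = <[veronese d a b]>%VS].

Arguments rational_normal_curve K d : clear implicits.

Definition Phi (R : realType) (n : nat) (X : set {vspace 'rV[R[i]]_n})
    (Q : {dot 'rV[R]_n for idfun}) : nat := EDdegree Q X.

(* Main.v *)
Require Import Defs.
From HB Require Import structures.
From mathcomp Require Import all_boot all_order all_algebra.
From mathcomp Require Import sesquilinear.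
From mathcomp Require Import complex.
From mathcomp Require Import boolp classical_sets cardinality reals.
From mathcomp Require Import mpoly.
From mathcomp Require Import separable cyclotomic ring zify.

Set Implicit Arguments.
Unset Strict Implicit.
Unset Printing Implicit Defensive.

Import Order.TTheory GRing.Theory Num.Theory.

Local Open Scope classical_set_scope.
Local Open Scope ring_scope.

(** Fix an inner product [Q] with complexified matrix [A]. Up to scalars the cone
over the rational normal curve consists of the points
[nu t = (t^d, ..., t, 1)] of an affine chart and of their limit at infinity. Put
[q t = Q (nu t, nu t)] ([qform], of degree [2 d]) and [l t = Q (u, nu t)]
([lform], of degree at most [d]); since [Q] is nondegenerate, a general [u] gives
a general [l]. At [s * nu t] with [s != 0] the cone is smooth and its tangent space
is spanned by [nu t] and [nu' t], so such a point is critical for [u] exactly when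
[l t = s * q t] and [2 * l' t = s * q' t]. Hence [2 * l' * q = l * q'] at [t].

This equation always has the multiple roots of [q] among its solutions, and they do
not come from critical points. Writing [q = rho * g] and [q' = sigma * g] with
[g = gcd (q, q')], what remains is [h = 2 * l' * rho - l * sigma] ([hform]), whose
degree is [d + r - 2] with [r] the number of distinct roots of [q]. For general [u]
the polynomial [h] has that degree and only simple roots, [l] and [q] do not vanish at
them, and neither the origin nor the points at infinity are critical. So [t] determines
[s = l t / q t] and the ED degree is [d + r - 2] ([card_critical_points],
[for_general_card_critical]).

That [h] is separable for general [u] amounts to the nonvanishing of its discriminant,
a polynomial in [u] ([for_general_separable]); a separable member is found in a pencil
by a Bertini argument ([separable_pencil], [hform_separable_exists]).

Finally [q] is a real polynomial without real roots, so conjugation pairs its roots: [r]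
is even and [2 <= r <= 2 d], which leaves the values [d, d + 2, ..., 3 d - 2]
([Phi_values]). All of them occur for diagonal [Q]: a product of [d] factors [X^2 + a]
with [a > 0] has positive coefficients, hence is [q] for a positive diagonal form, and it
has [2 (k + 1)] distinct roots when the numbers [a] take [k + 1] distinct values
([Phi_surj]). *)

(** * Polynomial curves, tangent vectors and polynomial functions *)

Lemma poly_nonroot (K : numFieldType) (p : {poly K}) (s : seq K) :
  p != 0 -> exists2 x, x \notin s & p.[x] != 0.
Proof.
move=> p0; pose q := p * \prod_(z <- s) ('X - z%:P).
have q0 : q != 0.
  by rewrite mulf_neq0 // prodf_seq_neq0; apply/allP => z _; rewrite polyXsubC_eq0.
have [x /negPf xNr] : exists x : K, ~~ root q x.
  apply: contrapT => /forallNP allr; move/eqP: q0; apply.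
  apply: (@roots_geq_poly_eq0 _ q [seq i%:R | i <- iota 0 (size q)]).
  - by apply/allP => z _; apply/negPn/negP; apply: allr.
  - by rewrite map_inj_uniq ?iota_uniq //; apply: mulrIn; rewrite oner_eq0.
  - by rewrite size_map size_iota.
exists x.
  by apply: contraFN xNr => xs; rewrite rootM root_prod_XsubC xs orbT.
by apply: contraFN xNr => /eqP px; rewrite rootM /root px eqxx.
Qed.

Lemma poly_eq0_cofinite (K : numFieldType) (p : {poly K}) (s : seq K) :
  (forall x, x \notin s -> p.[x] = 0) -> p = 0.
Proof.
move=> p0; apply/eqP/negPn/negP => /(poly_nonroot s)[x /p0->].
by rewrite eqxx.
Qed.

Section PolynomialCurves.
Variables (K : numFieldType) (n : nat).
Implicit Types (g : 'rV[{poly K}]_n) (f : {mpoly K[n]}).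

Definition curve_at g t : 'rV[K]_n := map_mx (fun p => p.[t]) g.

Definition pullback g f : {poly K} := mmap polyC (g 0) f.

Lemma horner_pullback g f t : (pullback g f).[t] = f.@[curve_at g t 0].
Proof.
rewrite /pullback /mmap horner_sum mevalE; apply: eq_bigr => m _.
rewrite hornerM hornerC /mmap1 horner_prod; congr (_ * _).
by apply: eq_bigr => i _; rewrite horner_exp mxE.
Qed.

(** Both sides are derivations along the curve, so it is enough to compare them on
constants and variables. *)
Lemma deriv_pullback g f :
  (pullback g f)^`() = \sum_i pullback g f^`M(i) * (g 0 i)^`().
Proof.
pose P f := (pullback g f)^`() = \sum_i pullback g f^`M(i) * (g 0 i)^`().
have PD f1 f2 : P f1 -> P f2 -> P (f1 + f2).
  rewrite /P /pullback => p1 p2; rewrite mmapD derivD p1 p2 -big_split.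
  by apply: eq_bigr => i _ /=; rewrite mderivD mmapD mulrDl.
have PM f1 f2 : P f1 -> P f2 -> P (f1 * f2).
  rewrite /P /pullback => p1 p2; rewrite rmorphM derivM p1 p2 mulr_suml mulr_sumr.
  rewrite -big_split; apply: eq_bigr => i _ /=; rewrite mderivM rmorphD !rmorphM /=.
  by ring.
have PC c : P c%:MP.
  rewrite /P /pullback mmapC derivC big1 // => i _.
  by rewrite mderivC mmap0 mul0r.
have PX i : P 'X_i.
  rewrite /P /pullback mmapX mmap1U (bigD1 i) //= big1 ?addr0.
    have UK : (U_(i) - U_(i) = 0)%MM by rewrite -[X in (X - _)%MM]add0m addmK.
    by rewrite mderivX mnm1E eqxx scale1r UK mpolyX0 rmorph1 mul1r.
  move=> j ji; rewrite mderivX mnm1E eq_sym (negPf ji) scale0r mmap0.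
  by rewrite mul0r.
have P1 : P 1 by rewrite -mpolyC1.
elim/mpolyind: f => [|c m p _ _ Pp]; first by rewrite -mpolyC0; apply: PC.
apply: (PD) => //; rewrite -mul_mpolyC; apply: (PM); first exact: PC.
rewrite mpolyXE_id; apply: (big_ind P P1 PM) => i _.
by elim: (m i) => [|k IH]; rewrite ?expr0 // exprS; apply: (PM).
Qed.

(** A polynomial vanishing on a curve lying in [Y] has zero derivative along
it: this is where tangent vectors come from. *)
Lemma tangent_curve (Y : set 'rV[K]_n) g t :
    (forall s, Y (curve_at g s)) ->
  tangent_space Y (curve_at g t) (curve_at (map_mx (@deriv K) g) t).
Proof.
move=> Yg f If; have g0 : pullback g f = 0.
  by apply: (poly_eq0_cofinite (s := [::])) => s _; rewrite horner_pullback If.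
have := deriv_pullback g f; rewrite g0 deriv0 => /(congr1 (fun p => p.[t])).
rewrite horner0 horner_sum => /esym {2}<-; apply: eq_bigr => i _.
by rewrite hornerM horner_pullback !mxE.
Qed.

(** Partial derivatives of a polynomial function that is identically zero are
again identically zero, and in characteristic 0 the iterated derivatives at the
origin are the coefficients up to nonzero factors. *)
Lemma mpoly_eq0 f : (forall v : 'rV[K]_n, f.@[v 0] = 0) -> f = 0.
Proof.
move=> f0; apply/mpolyP => m; rewrite mcoeff0.
have [k] := ubnP (mdeg m); elim: k => // k IH in f m f0 *.
have [-> _|m0] := eqVneq m 0%MM.
  rewrite -(f0 0) mevalE {1}[f]mpolyE raddf_sum; apply: eq_bigr => m' _ /=.
  rewrite mcoeffZ mcoeffX; congr (_ * _).
  have [->|/eqP m'0] := eqVneq m' 0%MM.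
    by rewrite big1 // => i _; rewrite mnmE expr0.
  have [i mi] : exists i, m' i != 0%N.
    by apply: contrapT => /forallNP h; apply: m'0; apply/mnmP => i; rewrite mnmE;
      apply/eqP/negPn/negP/h.
  by rewrite (bigD1 i) //= mxE expr0n (negPf mi) mul0r.
have [i mi] : exists i, m i != 0%N.
  apply: contrapT => /forallNP h; move/eqP: m0; apply; apply/mnmP => i.
  by rewrite mnmE; apply/eqP/negPn/negP/h.
have Dm : m = (m - U_(i) + U_(i))%MM by rewrite submK // lep1mP.
rewrite ltnS => dm.
have f'0 (v : 'rV[K]_n) : (f^`M(i)).@[v 0] = 0.
  pose line : 'rV[{poly K}]_n := \row_j ((v 0 j)%:P + (i == j)%:R *: 'X).
  have /(_ f (fun v _ => f0 v)) := @tangent_curve setT line 0 (fun _ => I).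
  rewrite (bigD1 i) //= big1 => [|j ji]; last first.
    rewrite !mxE derivD derivC derivZ derivX eq_sym (negPf ji) scale0r addr0.
    by rewrite horner0 mulr0.
  rewrite !mxE derivD derivC derivZ derivX eqxx scale1r add0r hornerC mulr1 addr0.
  by move=> <-; apply: meval_eq => j; rewrite !mxE !hornerE.
have := IH _ (m - U_(i))%MM f'0; rewrite mcoeff_mderiv -Dm => /(_ _)/eqP.
rewrite -mulr_natr mulf_eq0 pnatr_eq0 orbF => h; apply/eqP/h.
by apply: leq_trans dm; rewrite [in ltnRHS]Dm mdegD mdeg1 addn1.
Qed.

End PolynomialCurves.

(** * Conditions that hold for a general vector *)

(** The Sylvester matrix depends on the degrees, which [f] preserves because the leading
coefficients survive. *)
Lemma resultant_map (aR rR : nzRingType) (f : {rmorphism aR -> rR}) (p q : {poly aR}) :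
    f (lead_coef p) != 0 -> f (lead_coef q) != 0 ->
  f (resultant p q) = resultant (map_poly f p) (map_poly f q).
Proof.
move=> fp fq; rewrite -det_map_mx /resultant /Sylvester_mx !size_map_poly_id0 //.
rewrite map_col_mx; congr (\det (col_mx _ _)); apply: map_lin1_mx => v;
  by rewrite map_poly_rV rmorphM /= map_rVpoly.
Qed.

Section Genericity.
Variables (K : numFieldType) (n : nat).
Implicit Types (P Q : 'rV[K]_n -> Prop).

(** Two incompatible properties cannot both be general: this is what makes the generic
number of critical points unique. *)
Lemma for_general_ex P : for_general P -> exists u, P u.
Proof.
case=> f f0 fP; have [u /eqP fu] : exists u : 'rV[K]_n, f.@[u 0] <> 0.
  by apply: contrapT => /forallNP h; move/eqP: f0; apply; apply: mpoly_eq0 => v;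
    apply: contrapT; apply: h.
by exists u; apply: fP.
Qed.

Lemma for_generalI P Q :
  for_general P -> for_general Q -> for_general (fun u => P u /\ Q u).
Proof.
case=> f f0 fP [g g0 gQ]; exists (f * g); first by rewrite mulf_neq0.
by move=> u; rewrite mevalM mulf_eq0 negb_or => /andP[/fP ? /gQ].
Qed.

Lemma for_generalW P Q : (forall u, P u -> Q u) -> for_general P -> for_general Q.
Proof. by move=> PQ [f f0 fP]; exists f => // u /fP /PQ. Qed.

Lemma for_generalT P : (forall u, P u) -> for_general P.
Proof. by move=> hP; exists 1; rewrite ?oner_neq0. Qed.

Lemma for_general_all (T : Type) (s : seq T) (P : T -> 'rV[K]_n -> bool) :
    (forall x, for_general (P x)) ->
  for_general (fun u => all (P ^~ u) s).
Proof.
move=> hP; elim: s => [|x s IH]; first exact: for_generalT.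
by apply: for_generalW (for_generalI (hP x) IH) => u [Px Ps] /=; apply/andP.
Qed.

Implicit Types (u : 'rV[K]_n).

Definition linear_mpoly (a : 'I_n -> K) : {mpoly K[n]} := \sum_j a j *: 'X_j.

Lemma meval_linear_mpoly (a : 'I_n -> K) u :
  (linear_mpoly a).@[u 0] = \sum_j u 0 j * a j.
Proof.
rewrite raddf_sum; apply: eq_bigr => j _ /=.
by rewrite mevalZ mevalXU mulrC.
Qed.

Lemma for_general_linear (a : 'I_n -> K) j :
  a j != 0 -> for_general (fun u : 'rV[K]_n => \sum_i u 0 i * a i != 0).
Proof.
move=> aj; exists (linear_mpoly a); last by move=> u; rewrite meval_linear_mpoly.
apply: contraNneq aj => a0; have := meval_linear_mpoly a 'e_j.
rewrite a0 meval0 (bigD1 j) //= big1 => [|i ij].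
  by rewrite mxE !eqxx mul1r addr0 => <-.
by rewrite mxE (negPf ij) andbF mul0r.
Qed.

Lemma for_general_mulmx (A : 'M[K]_n) P : A \in unitmx ->
  for_general P -> for_general (fun u => P (u *m A)).
Proof.
move=> uA [f f0 fP]; pose s := [tuple linear_mpoly (fun i => A i j) | j < n].
have fE u : (f \mPo s).@[u 0] = f.@[(u *m A) 0].
  rewrite comp_mpoly_meval; apply: meval_eq => j.
  by rewrite tnth_mktuple meval_linear_mpoly mxE.
exists (f \mPo s); last by move=> u; rewrite fE => /fP.
apply: contraNneq f0 => fs0; apply/eqP/mpoly_eq0 => v.
by rewrite -(mulmxKV uA v) -fE fs0 meval0.
Qed.

(** The discriminant of [p u] is a polynomial in [u], namely the resultant of
the generic polynomial and its derivative; so one separable member of the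
expected degree makes the general member separable of that degree. *)
Lemma for_general_separable (p : {linear 'rV[K]_n -> {poly K}}) (N : nat) u0 :
    (1 < N)%N -> (forall u, (size (p u) <= N)%N) ->
    size (p u0) = N -> separable_poly (p u0) ->
  for_general (fun u => size (p u) = N /\ separable_poly (p u)).
Proof.
move=> N1 szp szu0 sepu0.
pose U : {poly {mpoly K[n]}} :=
  \poly_(i < N) linear_mpoly (fun j => (p 'e_j)`_i).
have coefU i u : (p u)`_i = (linear_mpoly (fun j => (p 'e_j)`_i)).@[u 0].
  rewrite meval_linear_mpoly [in LHS](row_sum_delta u) linear_sum coef_sum.
  by apply: eq_bigr => j _; rewrite linearZ /= coefZ.
have mapU u : map_poly (meval (u 0)) U = p u.
  apply/polyP => i; rewrite coef_map /= coef_poly coefU; case: ltnP => //= Ni.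
  by rewrite meval0 -coefU nth_default // (leq_trans (szp u)).
have szU : size U = N.
  by apply/eqP; rewrite eqn_leq size_poly /= -[X in (X <= _)%N]szu0 -mapU size_poly.
have N0 : N.-1.+1 = N by rewrite prednK // ltnW.
have szU' : size U^`() = N.-1.
  apply/eqP; rewrite eqn_leq; apply/andP; split.
    by rewrite -ltnS N0 -szU lt_size_deriv // -size_poly_eq0 szU -lt0n ltnW.
  have [k Nk] : exists k, N = k.+2 by case: (N) N1 => [|[|k]] // _; exists k.
  rewrite Nk /= ltnNge; apply/negP => /leq_sizeP/(_ k (leqnn k)).
  rewrite coef_deriv => /(congr1 (meval (u0 0))).
  rewrite mevalMn meval0 -coef_map mapU -mulr_natr => /eqP.
  rewrite mulf_eq0 pnatr_eq0 orbF.
  have -> : k.+1 = (size (p u0)).-1 by rewrite szu0 Nk.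
  by rewrite -lead_coefE lead_coef_eq0 -size_poly_eq0 szu0 Nk.
have lcU' : lead_coef U^`() = lead_coef U *+ N.-1.
  by rewrite !lead_coefE szU' szU coef_deriv; case: (N) N1 => [|[]].
have spec u : (lead_coef U * resultant U U^`()).@[u 0] != 0 <->
    size (p u) = N /\ separable_poly (p u).
  have lcu : (lead_coef U).@[u 0] = (p u)`_N.-1.
    by rewrite -mapU coef_map lead_coefE szU.
  rewrite mevalM mulf_eq0 negb_or lcu.
  have eqsz : ((p u)`_N.-1 != 0) <-> (size (p u) = N).
    split=> [h|sz]; last first.
      rewrite -[X in X.-1]sz -lead_coefE lead_coef_eq0 -size_poly_eq0 sz -lt0n.
      exact: ltnW.
    apply/eqP; rewrite eqn_leq szp -[X in (X <= _)%N]N0 ltnNge.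
    by apply: contra h => h; rewrite nth_default.
  have [h|h] := pselect ((p u)`_N.-1 != 0); last first.
    by split=> [/andP[/h]|[/eqsz/h]].
  rewrite resultant_map -?deriv_map ?mapU ?lcU' /= ?lcu ?mevalMn ?lcu //; last first.
    by rewrite -mulr_natr mulf_neq0 // pnatr_eq0; case: (N) N1 => [|[]].
  rewrite resultant_eq0 -leqNgt unlock /coprimep h /=.
  have g0 : (0 < size (gcdp (p u) (p u)^`()))%N.
    rewrite lt0n size_poly_eq0 gcdp_eq0 negb_and; apply/orP; left.
    by apply: contraNneq h => ->; rewrite coef0.
  split=> [g1|[_ /eqP-> //]]; split; first exact/eqsz.
  by rewrite eqn_leq g1.
exists (lead_coef U * resultant U U^`()); last by move=> u /spec.
have /spec : size (p u0) = N /\ separable_poly (p u0) by [].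
by apply: contraNneq => ->; rewrite meval0.
Qed.

End Genericity.

(** * The cone over the rational normal curve and its tangent spaces *)

Section Cone.
Variables (K : numFieldType) (d : nat).
Hypothesis d_ge1 : (1 <= d)%N.

Local Notation C := (affine_cone (rational_normal_curve K d)).
Local Notation nu t := (veronese d t 1).
Local Notation nu_inf := (veronese d 1 0).

(** The derivative of [nu] at [t]. *)
Definition dveronese (t : K) : 'rV[K]_d.+1 :=
  \row_(i < d.+1) ((d - i)%:R * t ^+ (d - i).-1).

Lemma cone_veronese s a b : (a, b) != (0, 0) -> C (s *: veronese d a b).
Proof.
move=> ab; exists <[veronese d a b]>%VS; first by exists a, b.
by apply/vlineP; exists s.
Qed.

Lemma cone_nu s t : C (s *: nu t).
Proof. by apply: cone_veronese; rewrite xpair_eqE oner_eq0 andbF. Qed.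

Lemma veronese_affine (a b : K) : b != 0 -> veronese d a b = b ^+ d *: nu (a / b).
Proof.
move=> b0; apply/rowP => i; rewrite !mxE expr1n mulr1 expr_div_n.
rewrite -[in b ^+ d](subnK (ltn_ord i : (i <= d)%N)) exprD.
by field; rewrite expf_neq0.
Qed.

Lemma coneE x : C x -> (exists s t, x = s *: nu t) \/ (exists s, x = s *: nu_inf).
Proof.
case=> _ [a [b [ab ->]]] /vlineP[s ->].
have [b0|b0] := eqVneq b 0.
  right; exists (s * a ^+ d); apply/rowP => i; rewrite !mxE b0.
  case: (nat_of_ord i) => [|j]; rewrite ?expr0 ?subn0 ?expr1n ?mulr1 //.
  by rewrite expr0n !mulr0.
by left; exists (s * b ^+ d), (a / b); rewrite veronese_affine // scalerA.
Qed.

Lemma tangent_space_lin (Y : set 'rV[K]_d.+1) x a b v w :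
  tangent_space Y x v -> tangent_space Y x w -> tangent_space Y x (a *: v + b *: w).
Proof.
move=> Tv Tw f If; pose D (u : 'rV[K]_d.+1) := \sum_(i < d.+1) (f^`M(i)).@[x 0] * u 0 i.
rewrite -[LHS]/(D _); have -> : D (a *: v + b *: w) = a * D v + b * D w.
  rewrite !mulr_sumr -big_split; apply: eq_bigr => i _ /=.
  by rewrite !mxE; ring.
by rewrite /D Tv // Tw // !mulr0 addr0.
Qed.

(** The velocity along the line of the cone through the point. *)
Lemma tangent_ruling s a b : (a, b) != (0, 0) ->
  tangent_space C (s *: veronese d a b) (veronese d a b).
Proof.
move=> ab; pose g : 'rV[{poly K}]_d.+1 := \row_i ((veronese d a b 0 i) *: 'X).
have gE t : curve_at g t = t *: veronese d a b.
  by apply/rowP => i; rewrite !mxE hornerZ hornerX mulrC.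
have -> : s *: veronese d a b = curve_at g s by rewrite gE.
have -> : veronese d a b = curve_at (map_mx (@deriv K) g) s.
  by apply/rowP => i; rewrite !mxE derivZ derivX hornerZ hornerC mulr1.
by apply: tangent_curve => t; rewrite gE; apply: cone_veronese.
Qed.

(** The velocity along the curve [t |-> s *: nu t]. *)
Lemma tangent_dveronese s t : tangent_space C (s *: nu t) (s *: dveronese t).
Proof.
pose g : 'rV[{poly K}]_d.+1 := \row_i (s *: 'X^(d - i)).
have gE x : curve_at g x = s *: nu x.
  by apply/rowP => i; rewrite !mxE hornerZ hornerXn expr1n mulr1.
rewrite -gE; have -> : s *: dveronese t = curve_at (map_mx (@deriv K) g) t.
  by apply/rowP => i; rewrite !mxE derivZ derivXn hornerZ hornerMn hornerXn mulr_natl.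
by apply: tangent_curve => x; rewrite gE; apply: cone_nu.
Qed.

(** The velocity at infinity along the curve [x |-> s *: veronese d 1 x], which passes
through [s *: nu_inf] at [x = 0]. *)
Lemma tangent_infinity s :
  tangent_space C (s *: nu_inf) (s *: \row_(i < d.+1) (i == 1 :> nat)%:R).
Proof.
pose g : 'rV[{poly K}]_d.+1 := \row_i (s *: 'X^i).
have gE x : curve_at g x = s *: veronese d 1 x.
  by apply/rowP => i; rewrite !mxE hornerZ hornerXn expr1n mul1r.
rewrite -gE; set v := s *: _; have -> : v = curve_at (map_mx (@deriv K) g) 0.
  apply/rowP => i; rewrite !mxE derivZ derivXn hornerZ hornerMn hornerXn.
  by case: (nat_of_ord i) => [|[|j]]; rewrite ?mulr0n ?expr0n //= mul0rn.
apply: tangent_curve => x; rewrite gE; apply: cone_veronese.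
by rewrite xpair_eqE oner_eq0.
Qed.

(* Indices counted from the end, so that the [k]-th coordinate of [nu t] is
[t ^+ k]. *)
Let e k : 'I_d.+1 := inord (d - k).

Let eE k : (k <= d)%N -> (d - e k)%N = k.
Proof. by move=> kd; rewrite inordK ?subKn // ltnS leq_subr. Qed.

Let eP (i : 'I_d.+1) : i = e (d - i).
Proof. by apply/val_inj; rewrite /= inordK ?subKn ?ltnS ?leq_subr // -ltnS. Qed.

Lemma nu_rev (t : K) k : (k <= d)%N -> nu t 0 (e k) = t ^+ k.
Proof. by move=> kd; rewrite mxE eE // expr1n mulr1. Qed.

Lemma dveronese_rev t k : (k <= d)%N -> dveronese t 0 (e k) = k%:R * t ^+ k.-1.
Proof. by move=> kd; rewrite mxE eE. Qed.

Lemma dveronese_neq0 t : dveronese t != 0.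
Proof.
apply/eqP => /rowP/(_ (e 1)); rewrite dveronese_rev // mxE mulr1 => /eqP.
by rewrite oner_eq0.
Qed.

Lemma nu_dveronese_free (t : K) : free [:: nu t; dveronese t].
Proof.
rewrite free_cons seq1_free dveronese_neq0 span_seq1 andbT.
apply/negP => /vlineP[k] /rowP/(_ (e 0)); rewrite [RHS]mxE nu_rev // dveronese_rev //.
by rewrite mul0r mulr0 => /eqP; rewrite oner_eq0.
Qed.

Lemma quadric_vanishing k : (k < d)%N ->
  vanishing_ideal C ('X_(e k.+1) * 'X_(e 0) - 'X_(e k) * 'X_(e 1)).
Proof.
move=> kd x Cx; rewrite rmorphB !rmorphM /= !mevalXU.
case: (coneE Cx) => [[s [t ->]]|[s ->]].
  have sE j : (j <= d)%N -> (s *: nu t) 0 (e j) = s * t ^+ j.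
    by move=> jd; rewrite mxE nu_rev.
  by rewrite !sE // ?(ltnW kd) // expr1 exprS; ring.
have sE j : (0 < d - j)%N -> (s *: nu_inf) 0 (e j) = 0.
  move=> jd; rewrite 2!mxE inordK ?ltnS ?leq_subr // expr0n.
  by rewrite (negPf (lt0n_neq0 jd)) !mulr0.
by rewrite (sE 0%N) ?subn0 // (sE k) ?subn_gt0 // mulr0 mul0r subrr.
Qed.

(** Along the quadrics [x_(k+1) x_0 = x_k x_1] a tangent vector is determined by
its first two coordinates [w_0, w_1]: the recursion has the solution
[w_0 nu t + (w_1 - t w_0) nu' t]. *)
Lemma tangent_spaceE s t : s != 0 ->
  [set` <<[:: nu t; dveronese t]>>%VS] = tangent_space C (s *: nu t).
Proof.
move=> s0; apply/seteqP; split=> v /=.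
  rewrite span_cons span_seq1 => /memv_addP[_ /vlineP[a ->] [_ /vlineP[b ->] ->]].
  rewrite -[b](mulfVK s0) -[_ *: dveronese t]scalerA; apply: tangent_space_lin.
    by apply: tangent_ruling; rewrite xpair_eqE oner_eq0 andbF.
  exact: tangent_dveronese.
move=> Tv; pose w k := v 0 (e k).
pose D (f : {mpoly K[d.+1]}) := \sum_(i < d.+1) (f^`M(i)).@[(s *: nu t) 0] * v 0 i.
have DX i : D 'X_i = v 0 i.
  rewrite /D (bigD1 i) //= big1 => [|j ji]; rewrite mderivX mnm1E.
    rewrite eqxx scale1r -[X in 'X_[X - _]]add0m addmK mpolyX0 meval1 mul1r.
    by rewrite addr0.
  by rewrite eq_sym (negPf ji) scale0r meval0 mul0r.
have DM i j : D ('X_i * 'X_j) =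
    v 0 i * (s *: nu t) 0 j + (s *: nu t) 0 i * v 0 j.
  rewrite -!DX /D mulr_suml mulr_sumr -big_split; apply: eq_bigr => k _ /=.
  by rewrite mderivM rmorphD !rmorphM /= !mevalXU; ring.
have rec k : (k < d)%N -> w k.+1 = t * w k + t ^+ k * (w 1%N - t * w 0%N).
  move=> kd; have := Tv _ (quadric_vanishing kd).
  set f1 := _ * _; set f2 := _ * _ => h.
  have {h} : D f1 - D f2 = 0.
    rewrite -[RHS]h /D -sumrB; apply: eq_bigr => i _.
    by rewrite mderivB rmorphB mulrBl.
  rewrite /f1 /f2 !DM.
  have sE j : (j <= d)%N -> (s *: nu t) 0 (e j) = s * t ^+ j.
    by move=> jd; rewrite mxE nu_rev.
  rewrite !sE // ?(ltnW kd) // -!/(w _) expr1 exprS expr0 => h.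
  apply: (mulfI s0); apply/eqP; rewrite -subr_eq0 -h; apply/eqP.
  by ring.
have wE k : (k <= d)%N ->
    w k = w 0%N * t ^+ k + (w 1%N - t * w 0%N) * (k%:R * t ^+ k.-1).
  elim: k => [|k IH] kd; first by rewrite !mul0r mulr0 addr0 mulr1.
  rewrite rec // IH ?(ltnW kd) //; case: (k) => [|j] /=; first by rewrite !expr0; ring.
  by rewrite -[j.+2]addn1 -[j.+1]addn1 !natrD !exprD; ring.
have -> : v = w 0%N *: nu t + (w 1%N - t * w 0%N) *: dveronese t.
  apply/rowP => i; rewrite (eP i) -/(w _) wE ?leq_subr // [RHS]mxE.
  rewrite [X in _ = X + _]mxE [X in _ = _ + X]mxE.
  by rewrite nu_rev ?leq_subr // dveronese_rev ?leq_subr.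
by rewrite rpredD // rpredZ // memv_span // !inE eqxx ?orbT.
Qed.

End Cone.

(** * Algebraic dependence of three polynomials in two variables *)

Section Bidegree.
Variable K : numFieldType.
Implicit Types p q : {poly {poly K}}.

Definition bidegree_le (n : nat) p :=
  (size p <= n.+1)%N /\ forall i, (size (p`_i)%R <= n.+1)%N.

Lemma bidegree_exists p : exists n, bidegree_le n p.
Proof.
exists (maxn (size p) (\max_(i < size p) size (p`_i)%R)); split.
  by rewrite leqW // leq_maxl.
move=> i; have [ip|pi] := ltnP i (size p).
  by rewrite leqW // leq_max (leq_bigmax (Ordinal ip)) orbT.
by rewrite nth_default // size_poly0.
Qed.

Lemma bidegree_leW m n p : (m <= n)%N -> bidegree_le m p -> bidegree_le n p.
Proof.
move=> mn [sp cp]; split=> [|i]; first exact: leq_trans sp _.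
by apply: leq_trans (cp i) _.
Qed.

Lemma bidegree_leM m n p q :
  bidegree_le m p -> bidegree_le n q -> bidegree_le (m + n) (p * q).
Proof.
move=> [sp cp] [sq cq]; have szM (R : idomainType) (a b : {poly R}) :
    (size a <= m.+1)%N -> (size b <= n.+1)%N -> (size (a * b)%R <= (m + n).+1)%N.
  move=> am bn; apply: leq_trans (size_polyMleq a b) _.
  by move: (leq_add am bn); rewrite addSn addnS; lia.
split=> [|i]; first exact: szM.
rewrite coefM; apply: leq_trans (size_sum _ _ _) _.
by apply/bigmax_leqP => j _; apply: szM.
Qed.

Lemma bidegree_leX n k p : bidegree_le n p -> bidegree_le (k * n) (p ^+ k).
Proof.
move=> hp; elim: k => [|k IH]; last by rewrite exprS mulSn; apply: bidegree_leM.
split=> [|i]; first by rewrite expr0 size_poly1.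
by rewrite expr0 coef1; case: (i == 0)%N; rewrite ?size_poly1 ?size_poly0.
Qed.

(** Counting: the [M ^ 3] monomials of degree less than [M] in each of three
polynomials of bidegree at most [D] live in a space of dimension at most
[((3 D + 1) M) ^ 2], which is smaller than [M ^ 3] as soon as [M > (3 D + 1) ^ 2]. *)
Lemma bivariate_algebraic_dependence (m : nat) (g : 'I_m -> {poly {poly K}}) :
  (2 < m)%N -> exists2 P : {mpoly K[m]}, P != 0 & mmap (polyC \o polyC) g P = 0.
Proof.
move=> m2; pose i0 : 'I_m := Ordinal (ltnW (ltnW m2)).
pose i1 : 'I_m := Ordinal (ltnW m2); pose i2 := Ordinal m2.
have [D gD] : exists D, forall i, i \in [:: i0; i1; i2] -> bidegree_le D (g i).
  have [D0 g0] := bidegree_exists (g i0).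
  have [D1 g1] := bidegree_exists (g i1).
  have [D2 g2] := bidegree_exists (g i2).
  exists (D0 + D1 + D2)%N => i; rewrite !inE => /or3P[] /eqP->.
  - by apply: bidegree_leW g0; rewrite -addnA leq_addr.
  - by apply: bidegree_leW g1; rewrite addnAC leq_addl.
  - by apply: bidegree_leW g2; rewrite leq_addl.
pose N := (3 * D).+1; pose M := (N ^ 2).+1; pose E := (N * M)%N.
pose T : finType := ('I_M * 'I_M * 'I_M)%type.
pose mon (tau : T) : 'X_{1..m} :=
  (U_(i0) *+ tau.1.1 + U_(i1) *+ tau.1.2 + U_(i2) *+ tau.2)%MM.
have i01 : i0 != i1 by []. have i02 : i0 != i2 by []. have i12 : i1 != i2 by [].
have mon_inj : injective mon.
  move=> [[a b] c] [[a' b'] c'] /mnmP h.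
  have := h i0; have := h i1; have := h i2.
  rewrite !mnmDE !mulmnE !mnm1E !eqxx /= !mul1n !add0n !addn0.
  by move=> /val_inj-> /val_inj-> /val_inj->.
pose v tau : 'M[K]_(E, E) := \matrix_(r < E, s < E) (mmap1 g (mon tau))`_r`_s.
pose A : 'M[K]_(#|T|, E * E) := \matrix_(k < #|T|) mxvec (v (enum_val k)).
have rkA : (\rank A < #|T|)%N.
  apply: leq_ltn_trans (rank_leq_col A) _.
  rewrite !card_prod !card_ord /E /M; set N2 := (N ^ 2).+1.
  have : (N ^ 2 < N2)%N by [].
  have : (0 < N2)%N by []. nia.
have /rowV0Pn[c /sub_kermxP cA c0] : kermx A != 0.
  by rewrite -mxrank_eq0 mxrank_ker subn_eq0 -ltnNge.
pose P : {mpoly K[m]} := \sum_(k < #|T|) c 0 k *: 'X_[mon (enum_val k)].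
have bdmon tau : bidegree_le (3 * (D * M)) (mmap1 g (mon tau)).
  have bdi (i : 'I_m) (a : 'I_M) : i \in [:: i0; i1; i2] ->
      bidegree_le (D * M) (g i ^+ a).
    move=> /gD /(bidegree_leX a); apply: bidegree_leW.
    by rewrite mulnC leq_mul2l (ltnW (ltn_ord a)) orbT.
  have mM a b : mmap1 g (a + b)%MM = mmap1 g a * mmap1 g b.
    by apply: commr_mmap1_M => i x; apply: mulrC.
  have mX i a : mmap1 g (U_(i) *+ a)%MM = g i ^+ a.
    elim: a => [|a IH]; first by rewrite mulm0n mmap11.
    by rewrite mulmS mM mmap1U IH exprS.
  rewrite /mon !mM !mX (_ : 3 * _ = D * M + D * M + D * M)%N; last by lia.
  by do 2?apply: bidegree_leM; apply: bdi; rewrite !inE eqxx ?orbT.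
exists P.
  apply: contraNneq c0 => P0; apply/eqP/rowP => k.
  have := congr1 (mcoeff (mon (enum_val k))) P0.
  rewrite mcoeff0 raddf_sum /= (bigD1 k) //= big1 => [|j jk].
    by rewrite mcoeffZ mcoeffX eqxx mulr1 addr0 mxE.
  rewrite mcoeffZ mcoeffX (inj_eq mon_inj) (inj_eq enum_val_inj) (negPf jk).
  by rewrite mulr0.
rewrite raddf_sum /=; apply/polyP => r; apply/polyP => s.
rewrite !coef0 !coef_sum.
rewrite (eq_bigr (fun k => c 0 k * (mmap1 g (mon (enum_val k)))`_r`_s)); last first.
  by move=> k _; rewrite mmapZ mmapX /= !coefCM.
have [rE|rE] := ltnP r E; last first.
  rewrite big1 // => k _; have [sz _] := bdmon (enum_val k).
  rewrite [_`_r]nth_default ?coef0 ?mulr0 //; apply: leq_trans sz (leq_trans _ rE).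
  by rewrite /E /N mulnA [in leqRHS]mulSn -add1n leq_add2r.
have [sE|sE] := ltnP s E; last first.
  rewrite big1 // => k _; have [_ /(_ r) sz] := bdmon (enum_val k).
  rewrite [_`_s]nth_default ?mulr0 //; apply: leq_trans sz (leq_trans _ sE).
  by rewrite /E /N mulnA [in leqRHS]mulSn -add1n leq_add2r.
have /rowP/(_ (mxvec_index (Ordinal rE) (Ordinal sE))) := cA.
rewrite [RHS]mxE mxE => h; rewrite -[RHS]h; apply: eq_bigr => k _.
by rewrite !mxE mxvecE mxE.
Qed.
End Bidegree.

(** * Dimension and smoothness of the cone *)

Section ConeDimension.
Variables (K : numFieldType) (d : nat).
Hypothesis d_ge1 : (1 <= d)%N.

Local Notation C := (affine_cone (rational_normal_curve K d)).
Local Notation nu t := (veronese d t 1).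
Local Notation nu_inf := (veronese d 1 0).

(** The points [s *: nu_inf] are in the closure of the chart: on the curve
[x |-> s *: veronese d 1 x] only the point [x = 0] lies outside it. *)
Lemma vanishing_ideal_affine (f : {mpoly K[d.+1]}) :
  (forall s t : K, f.@[(s *: nu t) 0] = 0) -> vanishing_ideal C f.
Proof.
move=> f0 x /coneE[[s [t ->//]]|[s ->]].
pose g : 'rV[{poly K}]_d.+1 := \row_i (s *: 'X^i).
have gE t : curve_at g t = s *: veronese d 1 t.
  by apply/rowP => i; rewrite !mxE hornerZ hornerXn expr1n mul1r.
suff g0 : pullback g f = 0 by rewrite -gE -horner_pullback g0 horner0.
apply: (poly_eq0_cofinite (s := [:: 0])) => t; rewrite inE => t0.
by rewrite horner_pullback gE veronese_affine // scalerA f0.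
Qed.

Lemma horner2_mmap (m : nat) (g : 'I_m -> {poly {poly K}}) (P : {mpoly K[m]}) s t :
  (mmap (polyC \o polyC) g P).[s%:P].[t] = P.@[fun i => (g i).[s%:P].[t]].
Proof.
rewrite /mmap !horner_sum mevalE; apply: eq_bigr => a _ /=.
rewrite !hornerM !hornerC /mmap1 !horner_prod; congr (_ * _).
by apply: eq_bigr => i _; rewrite !horner_exp.
Qed.

(** The last two coordinates of [s *: nu t] are [s * t] and [s], which are independent;
three polynomials restricted to the cone are polynomials in [s] and [t], hence
dependent. *)
Lemma cone_dimension : has_dimension C 2.
Proof.
split.
  exists [tuple 'X_(inord (d - 1)); 'X_(inord (d - 0))] => P CP.
  have X1_neq0 : 'X_1 != 0 :> {mpoly K[2]} by rewrite -msize_poly_eq0 msizeX mdeg1.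
  apply/eqP; rewrite -(mulIr_eq0 P (mulIf X1_neq0)); apply/eqP/mpoly_eq0 => v.
  rewrite mevalM mevalXU; have [->|v1] := eqVneq (v 0 1) 0; first by rewrite mulr0.
  have := CP _ (cone_nu d (v 0 1) (v 0 0 / v 0 1)); rewrite comp_mpoly_meval.
  rewrite (_ : P.@[_] = P.@[v 0]); first by move=> ->; rewrite mul0r.
  apply: meval_eq => i.
  case: i => [[|[|//]] i2]; rewrite (tnth_nth 0) /= mevalXU.
    by rewrite [LHS]mxE nu_rev // expr1 mulrC divfK //; congr (v 0 _); apply/val_inj.
  by rewrite [LHS]mxE nu_rev // expr0 mulr1; congr (v 0 _); apply/val_inj.
move=> m f indf; rewrite leqNgt; apply/negP => m2.
pose h (j : 'I_d.+1) : {poly {poly K}} := ('X^(d - j))%:P * 'X.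
pose g i := mmap (polyC \o polyC) h (tnth f i).
have [P P0 gP] := bivariate_algebraic_dependence g m2.
move/eqP: P0; apply; apply: indf; apply: vanishing_ideal_affine => s t.
have := congr1 (fun p => p.[s%:P].[t]) gP; rewrite horner2_mmap !horner0 => h0; rewrite -[RHS]h0.
rewrite comp_mpoly_meval; apply: meval_eq => i; rewrite horner2_mmap.
apply: meval_eq => j; rewrite /h !hornerE.
by rewrite !mxE expr1n mulr1 mulrC.
Qed.

Lemma smooth_nu s t : s != 0 -> smooth_locus C (s *: nu t).
Proof.
move=> s0; split; first exact: cone_nu.
exists <<[:: nu t; dveronese d t]>>%VS; split; first exact: tangent_spaceE.
by have /eqP-> := nu_dveronese_free d_ge1 t; apply: cone_dimension.
Qed.

End ConeDimension.

(** * Linear and quadratic forms on the affine chart *)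

Section BinaryForms.
Variables (K : numFieldType) (d : nat).
Implicit Types (w v : 'rV[K]_d.+1) (A : 'M[K]_d.+1).

Local Notation nu t := (veronese d t 1).

Definition dot w v : K := \sum_i w 0 i * v 0 i.

Lemma form_dot A w v : form_of_matrix idfun A w v = dot (w *m A) v.
Proof.
rewrite /form_of_matrix trace_mx11 mxE; apply: eq_bigr => i _.
by rewrite !mxE.
Qed.

Lemma dotBl w w' v : dot (w - w') v = dot w v - dot w' v.
Proof. by rewrite /dot -sumrB; apply: eq_bigr => i _; rewrite !mxE mulrBl. Qed.

Lemma dotZl a w v : dot (a *: w) v = a * dot w v.
Proof. by rewrite /dot mulr_sumr; apply: eq_bigr => i _; rewrite !mxE mulrA. Qed.

Lemma dotZr a w v : dot w (a *: v) = a * dot w v.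
Proof. by rewrite /dot mulr_sumr; apply: eq_bigr => i _; rewrite !mxE; ring. Qed.

Lemma dotDr w v v' : dot w (v + v') = dot w v + dot w v'.
Proof. by rewrite /dot -big_split; apply: eq_bigr => i _; rewrite !mxE mulrDr. Qed.

Lemma dot_mulmx A w v : dot (w *m A) v = \sum_i w 0 i * dot (row i A) v.
Proof.
rewrite /dot; under eq_bigr do rewrite mxE mulr_suml.
rewrite exchange_big; apply: eq_bigr => i _; rewrite mulr_sumr.
by apply: eq_bigr => j _; rewrite !mxE mulrA.
Qed.

Lemma dot_sym A w v : A^T = A -> dot (w *m A) v = dot (v *m A) w.
Proof.
move=> At; rewrite dot_mulmx; apply: eq_bigr => i _; rewrite mulrC; congr (_ * _).
by rewrite mxE; apply: eq_bigr => j _; rewrite mxE -[in LHS]At mxE mulrC.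
Qed.

(** The pullback [t |-> dot w (nu t)] of the linear form [w] to the affine chart. *)
Definition lform w : {poly K} := \poly_(k < d.+1) w 0 (inord (d - k)).

Lemma lform_is_linear : linear lform.
Proof.
move=> a w v; apply/polyP => k; rewrite coefD coefZ !coef_poly.
by case: ifP => _; rewrite ?mxE // mulr0 addr0.
Qed.

HB.instance Definition _ :=
  GRing.isLinear.Build K 'rV[K]_d.+1 {poly K} *:%R lform lform_is_linear.

Lemma lform_surj (p : {poly K}) : (size p <= d.+1)%N -> exists w, lform w = p.
Proof.
move=> sp; exists (\row_i p`_(d - i)); apply/polyP => k; rewrite coef_poly.
case: ltnP => kd; last by rewrite nth_default // (leq_trans sp).
by rewrite mxE inordK ?ltnS ?leq_subr // subKn.
Qed.

Let inord_rev (i : 'I_d.+1) : inord (d - rev_ord i) = i :> 'I_d.+1.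
Proof. by apply/val_inj; rewrite /= subSS subKn ?inordK // -ltnS. Qed.

Lemma lformE w : lform w = \sum_i w 0 i *: 'X^(d - i).
Proof.
rewrite /lform poly_def (reindex_inj rev_ord_inj); apply: eq_bigr => i _.
by rewrite inord_rev /= subSS.
Qed.

Lemma horner_lform w t : (lform w).[t] = dot w (nu t).
Proof.
rewrite lformE horner_sum; apply: eq_bigr => i _.
by rewrite hornerZ hornerXn mxE expr1n mulr1.
Qed.

Lemma horner_deriv_lform w t : (lform w)^`().[t] = dot w (dveronese d t).
Proof.
rewrite lformE raddf_sum horner_sum; apply: eq_bigr => i _ /=.
by rewrite derivZ derivXn hornerZ hornerMn hornerXn mxE mulr_natl.
Qed.

(** The pullback [t |-> dot (nu t *m A) (nu t)] of the quadratic form [A] to the affine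
chart. *)
Definition qform A : {poly K} := \sum_i lform (row i A) * 'X^(d - i).

Lemma horner_qform A t : (qform A).[t] = dot (nu t *m A) (nu t).
Proof.
rewrite dot_mulmx horner_sum; apply: eq_bigr => i _.
by rewrite hornerM hornerXn horner_lform mulrC [nu t 0 i]mxE expr1n mulr1.
Qed.

Lemma horner_deriv_qform A t : A^T = A ->
  (qform A)^`().[t] = 2 * dot (nu t *m A) (dveronese d t).
Proof.
move=> At; rewrite mulr_natl mulr2n [X in X + _](dot_sym _ _ At) !dot_mulmx.
rewrite raddf_sum horner_sum -big_split; apply: eq_bigr => i _ /=.
rewrite derivM hornerD !hornerM hornerXn derivXn hornerMn hornerXn.
rewrite horner_deriv_lform horner_lform [nu t 0 i]mxE [dveronese d t 0 i]mxE.
by rewrite expr1n mulr1 -mulr_natl; ring.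
Qed.

Lemma size_qform A : A 0 0 != 0 -> size (qform A) = (2 * d).+1.
Proof.
move=> A0; apply/eqP; rewrite eqn_leq; apply/andP; split.
  apply: leq_trans (size_sum _ _ _) _; apply/bigmax_leqP => i _.
  apply: leq_trans (size_polyMleq _ _) _; rewrite size_polyXn addnS /=.
  rewrite mul2n -addnn -addSn leq_add ?leq_subr //; exact: size_poly.
rewrite ltnNge; apply: contra A0 => /leq_sizeP/(_ _ (leqnn _))/eqP.
rewrite coef_sum (bigD1 ord0) //= big1 => [|i i0].
  rewrite addr0 coefMXn subn0 ltnNge mul2n -addnn leq_addl /= addnK.
  rewrite coef_poly ltnSn subnn mxE; congr (A _ _ == 0); apply/val_inj => //=.
  by rewrite inordK.
rewrite coefMXn; case: ltnP => // _; rewrite coef_poly; case: ltnP => //.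
have : (0 < i)%N by rewrite lt0n.
by have := ltn_ord i; lia.
Qed.

End BinaryForms.

(** * Radicals and pencils of univariate polynomials *)

Section UnivariatePolynomials.
Variable K : numClosedFieldType.
Implicit Types p q : {poly K}.

Lemma coefM_top p q m n : (size p <= m.+1)%N -> (size q <= n.+1)%N ->
  (p * q)`_(m + n) = p`_m * q`_n.
Proof.
move=> sp sq; have mi : (m < (m + n).+1)%N by rewrite ltnS leq_addr.
rewrite coefM (bigD1 (Ordinal mi)) //= addKn big1 ?addr0 // => i im.
have [lt_im|lt_mi|eq_im] := ltngtP i m.
- by rewrite [q`__]nth_default ?mulr0 // (leq_trans sq) //; lia.
- by rewrite nth_default ?mul0r // (leq_trans sp).
- by case/eqP: im; apply/val_inj.
Qed.

Lemma size_derivE p : size p^`() = (size p).-1.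
Proof.
have [->|p0] := eqVneq p 0; first by rewrite deriv0 size_poly0.
apply/eqP; rewrite eqn_leq -ltnS prednK ?lt_size_deriv ?size_poly_gt0 //=.
case E : (size p) => [|[|k]] //=; rewrite ltnNge; apply/negP.
move=> /leq_sizeP/(_ k (leqnn _)); rewrite coef_deriv -mulr_natr => /eqP.
rewrite mulf_eq0 pnatr_eq0 orbF; have -> : k.+1 = (size p).-1 by rewrite E.
by rewrite -lead_coefE lead_coef_eq0 (negPf p0).
Qed.

Lemma lead_coef_derivE p : lead_coef p^`() = lead_coef p *+ (size p).-1.
Proof.
rewrite !lead_coefE size_derivE coef_deriv; case E : (size p) => [|[|k]] //=;
  by rewrite [RHS]mulr0n nth_default ?E // mul0rn.
Qed.

(** A root of multiplicity [m] of [p] is a root of multiplicity [m - 1] of [p'], hence of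
[gcd (p, p')], so dividing by the gcd leaves each root of [p] exactly once. *)
Lemma radical_factorization p : p != 0 ->
  exists rho sigma g, [/\ p = rho * g, p^`() = sigma * g, coprimep rho sigma,
    separable_poly rho & forall z, root p z = root rho z].
Proof.
move=> p0; pose g := gcdp p p^`(); exists (p %/ g), (p^`() %/ g), g.
have pE : p = p %/ g * g by rewrite divpK ?dvdp_gcdl.
split=> //; first by rewrite divpK ?dvdp_gcdr.
- by rewrite coprimep_div_gcd // p0.
- exact: make_separable.
move=> z; apply/idP/idP => [pz|rz]; last first.
  by apply: root_dvdp rz; rewrite [X in _ %| X]pE dvdp_mulr.
apply: contraT => rz.
have [m [q]] := multiplicity_XsubC p z; rewrite p0 /= => qz pm.
case: m pm => [|m] pm; first by rewrite pm mulr1 (negPf qz) in pz.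
have dvdg : ('X - z%:P) ^+ m.+1 %| g.
  rewrite -(@Gauss_dvdpr _ _ (p %/ g)) -?pE; first by rewrite [X in _ %| X]pm dvdp_mull.
  by apply: coprimep_expl; rewrite coprimep_sym coprimep_XsubC.
have := dvdp_trans dvdg (dvdp_gcdr p p^`()).
rewrite pm derivM deriv_exp derivXsubC mul1r exprS -mulr_natl.
rewrite (_ : _ + q * _ =
    (q^`() * ('X - z%:P) + m.+1%:R * q) * ('X - z%:P) ^+ m); last first.
  by rewrite /=; ring.
rewrite dvdp_mul2r ?expf_neq0 ?polyXsubC_eq0 // dvdp_XsubCl rootE !hornerE.
rewrite subrr mulr0 add0r.
by rewrite -polyC_natr hornerC mulf_eq0 pnatr_eq0 /= -rootE (negPf qz).
Qed.

(** Each root of [p] excludes at most one value of [c], because [q1] and [q2] do not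
vanish there together. *)
Lemma coprimep_pencil p q1 q2 : p != 0 ->
  (forall z, root q1 z -> root q2 z -> False) ->
  exists c, coprimep p (q1 + c *: q2).
Proof.
move=> p0 q12; have [rs pE] := closed_field_poly_normal p.
pose b := \prod_(z <- rs) (q1.[z]%:P + q2.[z] *: 'X).
have b0 : b != 0.
  rewrite prodf_seq_neq0; apply/allP => z _ /=; apply/eqP => /polyP bz.
  apply: (q12 z).
    by have := bz 0%N; rewrite coefD coefC coefZ coefX mulr0 addr0 coef0 => /eqP.
  by have := bz 1%N; rewrite coefD coefC coefZ coefX mulr1 add0r coef0 => /eqP.
have [c _ bc] := poly_nonroot [::] b0; exists c.
apply/Pdiv.ClosedField.coprimepP => z; rewrite pE rootZ ?lead_coef_eq0 //.
rewrite root_prod_XsubC => zrs; move: bc; rewrite horner_prod prodf_seq_neq0.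
by move=> /allP/(_ z zrs) /=; rewrite !hornerE mulrC.
Qed.

(** Bertini for pencils on the line: a double root of [p + c q] is a zero of the
Wronskian [p q' - p' q], and each zero of the Wronskian excludes at most one
value of [c]. *)
Lemma separable_pencil p q : (1 < size p)%N -> coprimep p q ->
  exists2 b : {poly K}, b != 0 & forall c, b.[c] != 0 -> separable_poly (p + c *: q).
Proof.
move=> p1 pq; pose W := p * q^`() - p^`() * q.
have p0 : p != 0 by rewrite -size_poly_gt0 (ltn_trans _ p1).
have W0 : W != 0.
  apply/eqP => /(canRL (subrK _)); rewrite add0r => WE.
  have : p %| p^`() by rewrite -(Gauss_dvdpl _ pq) -WE dvdp_mulr.
  have p'0 : p^`() != 0 by rewrite -size_poly_gt0 size_derivE; case: (size p) p1 => [|[]].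
  by move/(dvdp_leq p'0); rewrite leqNgt lt_size_deriv.
have [rs WE] := closed_field_poly_normal W.
exists (\prod_(z <- rs) (p.[z]%:P + q.[z] *: 'X)).
  rewrite prodf_seq_neq0; apply/allP => z _ /=; apply/eqP => /polyP bz.
  have pz : root p z.
    by have := bz 0%N; rewrite coefD coefC coefZ coefX mulr0 addr0 coef0 => /eqP.
  have := coprimep_root pq pz; have := bz 1%N.
  by rewrite coefD coefC coefZ coefX mulr1 add0r coef0 => ->; rewrite eqxx.
move=> c bc; rewrite unlock; apply/Pdiv.ClosedField.coprimepP => z pz.
apply: contraNneq bc => p'z; rewrite horner_prod prodf_seq_eq0.
move: pz p'z; rewrite rootE derivD derivZ !hornerE => /eqP pz p'z.
apply/hasP; exists z; last by rewrite /= !hornerE mulrC -pz; apply/eqP; ring.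
have lW : lead_coef W != 0 by rewrite lead_coef_eq0.
rewrite -root_prod_XsubC -(rootZ _ _ lW) -WE rootE !hornerE.
rewrite (canRL (addrK _) pz) (canRL (addrK _) p'z); apply/eqP; ring.
Qed.
End UnivariatePolynomials.

(** * The critical equation *)

Section CriticalEquation.
Variables (K : numClosedFieldType) (d0 r0 : nat).
Local Notation d := d0.+1.
Variables rho sigma : {poly K}.
Implicit Types (w : 'rV[K]_d.+1).

(** The numerator of [2 l' q - l q'], for [l = lform w], once the common factor of [q] and
[q'] is removed. *)
Definition hform w : {poly K} := 2 *: ((lform w)^`() * rho) - lform w * sigma.

Lemma hform_is_linear : linear hform.
Proof.
move=> a w v; rewrite /hform linearP /= derivD derivZ -!mul_polyC.
by ring.
Qed.

HB.instance Definition _ :=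
  GRing.isLinear.Build K 'rV[K]_d.+1 {poly K} *:%R hform hform_is_linear.

Lemma horner_hform w t :
  (hform w).[t] = 2 * ((lform w)^`().[t] * rho.[t]) - (lform w).[t] * sigma.[t].
Proof. by rewrite !hornerE. Qed.

Hypothesis size_rho : size rho = r0.+2.
Hypothesis size_sigma : size sigma = r0.+1.
Hypothesis lead_sigma : lead_coef sigma = (2 * d)%:R * lead_coef rho.
Hypothesis coprime_rho_sigma : coprimep rho sigma.

Let rho_top : rho`_r0.+1 = lead_coef rho.
Proof. by rewrite lead_coefE size_rho. Qed.

Let sigma_top : sigma`_r0 = (2 * d)%:R * lead_coef rho.
Proof. by rewrite -lead_sigma lead_coefE size_sigma. Qed.

(** Both summands may have degree [d0 + r0 + 1]; since [lead_coef sigma] is [2 d] times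
[lead_coef rho], their coefficients in that degree are equal. *)
Lemma size_hform w : (size (hform w) <= (d0 + r0).+1)%N.
Proof.
have sl : (size (lform w) <= d0.+2)%N by apply: size_poly.
have sl' : (size (lform w)^`() <= d0.+1)%N by rewrite size_derivE -subn1 leq_subLR add1n.
apply/leq_sizeP => j; rewrite leq_eqVlt => /predU1P[<-|jN].
  rewrite coefB coefZ -[in X in _ - X]addSn -[in X in X - _]addnS.
  rewrite !coefM_top ?size_rho ?size_sigma // coef_deriv rho_top sigma_top.
  by rewrite natrM -mulr_natl; ring.
apply: nth_default; apply: leq_trans jN.
apply: leq_trans (size_polyD _ _) _; rewrite geq_max size_polyN; apply/andP; split.
  apply: leq_trans (size_scale_leq _ _) _; apply: leq_trans (size_polyMleq _ _) _.
  by rewrite size_rho; move: (size _) sl' => x; lia.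
by apply: leq_trans (size_polyMleq _ _) _; rewrite size_sigma; move: (size _) sl => x; lia.
Qed.

Hypothesis r0_gt0 : (0 < r0)%N.

(** The pencil is spanned by the images of [X ^ d0], which has the right degree, and of
[1 + c X] for a [c] making the two images coprime; such a [c] exists because the images
of [1] and [X], namely [- sigma] and [2 rho - X sigma], have no common root. *)
Lemma hform_separable_exists :
  exists w, size (hform w) = (d0 + r0).+1 /\ separable_poly (hform w).
Proof.
have lrho0 : lead_coef rho != 0 by rewrite lead_coef_eq0 -size_poly_gt0 size_rho.
have [w1 w1E] : exists w, lform w = 'X^d0 by apply: lform_surj; rewrite size_polyXn.
have [v0 v0E] : exists w, lform w = 1 by apply: lform_surj; rewrite size_poly1.
have [v1 v1E] : exists w, lform w = 'X by apply: lform_surj; rewrite size_polyX.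
have h1_top : (hform w1)`_(d0 + r0) = - 2 * lead_coef rho.
  rewrite coefB coefZ w1E coefXnM ltnNge leq_addr /= addKn sigma_top derivXn.
  rewrite mulrnAl coefMn coefXnM.
  case: (d0) => [|k]; first by rewrite mulr0n; ring.
  have -> : (k.+1 + r0 < k)%N = false by lia.
  have -> : (k.+1 + r0 - k = r0.+1)%N by lia.
  by rewrite rho_top -mulr_natl; ring.
have top_size w : (hform w)`_(d0 + r0) != 0 -> size (hform w) = (d0 + r0).+1.
  move=> h; apply/eqP; rewrite eqn_leq size_hform ltnNge.
  by apply: contra h => h; rewrite nth_default.
have h1_top0 : (hform w1)`_(d0 + r0) != 0.
  by rewrite h1_top mulf_neq0 // oppr_eq0 pnatr_eq0.
have h10 : hform w1 != 0 by apply: contraNneq h1_top0 => ->; rewrite coef0.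
have [c cop] : exists c, coprimep (hform w1) (hform v0 + c *: hform v1).
  apply: coprimep_pencil => // z; rewrite !rootE !horner_hform v0E v1E.
  rewrite -polyC1 derivC derivX horner0 !hornerC hornerX mul0r mulr0 !mul1r sub0r.
  rewrite oppr_eq0 => /eqP sz; rewrite sz mulr0 subr0 mulf_eq0 pnatr_eq0 /= => rz.
  by have := coprimep_root coprime_rho_sigma rz; rewrite sz eqxx.
have h1_gt1 : (1 < size (hform w1))%N by rewrite top_size // ltnS addn_gt0 r0_gt0 orbT.
have [b b0 bsep] := separable_pencil h1_gt1 cop.
pose b1 := ((hform w1)`_(d0 + r0))%:P + (hform v0 + c *: hform v1)`_(d0 + r0) *: 'X.
have b10 : b1 != 0.
  apply: contraNneq h1_top0 => /polyP/(_ 0%N).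
  by rewrite coefD coefC coefZ coefX mulr0 addr0 coef0 => /eqP.
have [e _] := poly_nonroot [::] (mulf_neq0 b0 b10).
rewrite hornerM mulf_eq0 negb_or => /andP[/bsep sep b1e].
exists (w1 + e *: (v0 + c *: v1)).
have hE : hform (w1 + e *: (v0 + c *: v1)) = hform w1 + e *: (hform v0 + c *: hform v1).
  by rewrite linearD linearZ [X in _ + _ *: X]linearD linearZ.
split; last by rewrite hE.
by apply: top_size; move: b1e; rewrite hE coefD coefZ !hornerE mulrC.
Qed.

Lemma for_general_hform : for_general (fun w =>
  size (hform w) = (d0 + r0).+1 /\ separable_poly (hform w)).
Proof.
have [w [sw sepw]] := hform_separable_exists.
apply: (for_general_separable (p := hform) _ _ sw sepw) => [|u]; last exact: size_hform.
by rewrite ltnS addn_gt0 r0_gt0 orbT.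
Qed.
End CriticalEquation.

(** * Critical points as roots of the critical equation *)

Lemma card_eq_uniq_seq (T : eqType) (s : seq T) : uniq s -> ([set` s] #= `I_(size s))%card.
Proof.
case: s => [_|x0 s us].
  by apply: card_esym; rewrite II0 (_ : [set` [::]] = set0) ?card_eqxx // predeqE.
have -> : [set` x0 :: s] = nth x0 (x0 :: s) @` `I_(size (x0 :: s)).
  apply/seteqP; split=> [x /(nthP x0)[i si <-]|_ [i si <-]]; first by exists i.
  exact: mem_nth.
apply: inj_card_eq => i j; rewrite !inE => si sj /eqP.
by rewrite nth_uniq // => /eqP.
Qed.

Section CriticalPoints.
Variables (K : numClosedFieldType) (d0 : nat).
Local Notation d := d0.+1.
Local Notation C := (affine_cone (rational_normal_curve K d)).
Local Notation nu t := (veronese d t 1).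
Local Notation nu_inf := (veronese d 1 0).
Variable A : 'M[K]_d.+1.
Hypothesis A_sym : A^T = A.
Implicit Types (u w : 'rV[K]_d.+1).

Definition critical_points u : set 'rV[K]_d.+1 :=
  [set x | smooth_locus C x /\
     forall v, tangent_space C x v -> form_of_matrix idfun A (u - x) v = 0].

Variables (rho sigma g : {poly K}) (N : nat).
Hypothesis qformE : qform A = rho * g.
Hypothesis deriv_qformE : (qform A)^`() = sigma * g.
Hypothesis coprime_rho_sigma : coprimep rho sigma.
Hypothesis root_rho : forall z, root (qform A) z = root rho z.

(** The first condition excludes the roots of [qform A] from the solutions of the critical
equation; by the second one [lform w] has simple roots, so none of them is a root of
[hform]; the third one excludes critical points at infinity, where the tangent vectors are
[e_0] and [e_1]. *)
Definition generic_functional w := [/\ coprimep rho (lform w), separable_poly (lform w),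
   w 0 0 * A 0 1 != w 0 1 * A 0 0 &
   size (hform rho sigma w) = N.+1 /\ separable_poly (hform rho sigma w)].

(** The two equations are the orthogonality of [u - s *: nu t] to the basis [nu t], [nu' t]
of the tangent space. *)
Lemma critical_affine u s t : s != 0 ->
  critical_points u (s *: nu t) <->
  (lform (u *m A)).[t] = s * (qform A).[t] /\
  2 * (lform (u *m A))^`().[t] = s * (qform A)^`().[t].
Proof.
move=> s0; rewrite horner_qform horner_deriv_qform // horner_lform horner_deriv_lform.
have formE v : form_of_matrix idfun A (u - s *: nu t) v =
    dot (u *m A) v - s * dot (nu t *m A) v.
  by rewrite form_dot mulmxBl -scalemxAl dotBl dotZl.
split=> [[_ crit]|[h1 h2]].
  have /crit : tangent_space C (s *: nu t) (nu t).
    by apply: tangent_ruling; rewrite xpair_eqE oner_eq0 andbF.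
  have /crit := @tangent_dveronese K d s t; rewrite !formE !dotZr => h2 /eqP.
  rewrite subr_eq0 => /eqP h1; split=> //; apply: (mulfI s0).
  apply/eqP; rewrite -subr_eq0; apply/eqP; rewrite -[RHS](mulr0 2) -h2; ring.
split; first exact: smooth_nu.
move=> v; rewrite -tangent_spaceE //= span_cons span_seq1.
move=> /memv_addP[_ /vlineP[a ->] [_ /vlineP[b ->] ->]].
rewrite formE !dotDr !dotZr h1.
have -> : dot (u *m A) (dveronese d t) = s * dot (nu t *m A) (dveronese d t).
  by apply: (@mulfI _ 2); rewrite ?pnatr_eq0 // h2; ring.
by ring.
Qed.

(** The cone is contained in the tangent space at the origin, and at infinity the two
tangent vectors [e_0] and [e_1] give the equation excluded by the third condition of
[generic_functional]. *)
Lemma critical_generic u x : generic_functional (u *m A) -> critical_points u x ->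
  exists s t, s != 0 /\ x = s *: nu t.
Proof.
move=> [_ /separable_poly_neq0 l0 inf _] cx; have [[Cx _] crit] := cx.
have x0 : x != 0.
  apply: contraNneq l0 => x0; apply/eqP.
  apply: (poly_eq0_cofinite (s := [::])) => t _; rewrite horner_lform.
  have /crit : tangent_space C x (nu t).
    rewrite x0 -(scale0r (nu t)).
    by apply: tangent_ruling; rewrite xpair_eqE oner_eq0 andbF.
  by rewrite x0 subr0 form_dot.
case: (coneE Cx) => [[s [t xE]]|[s xE]].
  by exists s, t; split=> //; apply: contraNneq x0 => s0; rewrite xE s0 scale0r.
have s0 : s != 0 by apply: contraNneq x0 => s0; rewrite xE s0 scale0r.
have formE v : form_of_matrix idfun A (u - x) v =
    dot (u *m A) v - s * dot (nu_inf *m A) v.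
  by rewrite xE form_dot mulmxBl -scalemxAl dotBl dotZl.
have nuE : nu_inf = 'e_0 :> 'rV[K]_d.+1.
  by apply/rowP => i; rewrite !mxE expr1n mul1r expr0n.
have e1E : \row_(i < d.+1) (i == 1 :> nat)%:R = 'e_1 :> 'rV[K]_d.+1.
  by apply/rowP => i; rewrite !mxE.
have dot_e w i : dot w 'e_i = w 0 i.
  rewrite /dot (bigD1 i) //= big1 => [|j ji]; first by rewrite mxE !eqxx mulr1 addr0.
  by rewrite mxE (negPf ji) andbF mulr0.
have /crit : tangent_space C x nu_inf.
  by rewrite xE; apply: tangent_ruling; rewrite xpair_eqE oner_eq0.
have /crit : tangent_space C x (s *: 'e_1) by rewrite xE -e1E; apply: tangent_infinity.
rewrite !formE !dotZr nuE !dot_e -rowE ![row _ _ _ _]mxE.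
move=> h1 h0; case/eqP: inf; apply: (mulfI s0).
have -> : (u *m A) 0 1 = s * A 0 1.
  by apply: (mulfI s0); apply/eqP; rewrite -subr_eq0 h1.
by move/eqP: h0; rewrite subr_eq0 => /eqP->; ring.
Qed.

(** The bijection sends a root [t] of [hform] to the point [s *: nu t] with
[s = l t / q t]. *)
Lemma card_critical_points u :
  generic_functional (u *m A) -> (critical_points u #= `I_N)%card.
Proof.
move=> gen; have [col sepl _ [szh seph]] := gen.
set l := lform (u *m A) in col sepl *; set h := hform _ _ _ in szh seph.
have [rs hE] := closed_field_poly_normal h.
have lh0 : lead_coef h != 0 by rewrite lead_coef_eq0 separable_poly_neq0.
have root_h t : root h t = (t \in rs) by rewrite hE rootZ // root_prod_XsubC.
have rs_uniq : uniq rs.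
  by rewrite -separable_prod_XsubC -(eqp_separable (eqp_scale _ lh0)) -hE.
have rs_size : size rs = N.
  by move: szh; rewrite hE size_scale // size_prod_XsubC => -[].
have q_neq0 t : t \in rs -> (qform A).[t] != 0.
  rewrite -root_h -rootE root_rho => ht; apply/negP => rt.
  move: ht; rewrite rootE horner_hform (eqP rt) mulr0 mulr0 sub0r oppr_eq0 mulf_eq0.
  rewrite (negPf (coprimep_root coprime_rho_sigma rt)) orbF.
  by rewrite (negPf (coprimep_root col rt)).
have critE t s : (qform A).[t] != 0 -> l.[t] = s * (qform A).[t] ->
    (2 * l^`().[t] = s * (qform A)^`().[t]) <-> root h t.
  rewrite rootE horner_hform -/l deriv_qformE qformE !hornerM mulf_eq0 negb_or.
  move=> /andP[rt gt] ->; split=> [e|].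
    apply/eqP; apply: (mulIf gt); rewrite mul0r mulrBl.
    rewrite (_ : 2 * _ * _ = 2 * l^`().[t] * rho.[t] * g.[t]); last by ring.
    by rewrite e; ring.
  move=> /eqP e; apply: (mulIf rt); apply/eqP; rewrite -subr_eq0 -e; apply/eqP.
  by ring.
pose phi t := (l.[t] / (qform A).[t]) *: nu t.
have l_neq0 t : t \in rs -> l.[t] != 0.
  move=> trs; apply/eqP => lt; have := trs; rewrite -root_h => /(critE t 0 (q_neq0 t trs)).
  rewrite lt !mul0r => /(_ erefl)/eqP; rewrite mulf_eq0 pnatr_eq0 /= => l't.
  move: sepl; rewrite unlock => /coprimep_root/(_ (introT eqP lt)).
  by rewrite (eqP l't) eqxx.
have phi_inj : {in rs &, injective phi}.
  move=> t t' trs t'rs /rowP e.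
  have := e ord_max; rewrite !mxE subnn !expr0 !expr1n !mulr1 => e0.
  have := e (inord d0); rewrite [LHS]mxE [RHS]mxE [nu t _ _]mxE [nu t' _ _]mxE !expr1n !mulr1.
  rewrite inordK // subSnn !expr1 -e0 => /mulfI; apply.
  by rewrite mulf_neq0 ?invr_neq0 ?l_neq0 ?q_neq0.
have -> : critical_points u = [set` [seq phi t | t <- rs]].
  apply/seteqP; split=> [x cx|x /= /mapP[t trs ->]]; last first.
    have s0 : l.[t] / (qform A).[t] != 0 by rewrite mulf_neq0 ?invr_neq0 ?l_neq0 ?q_neq0.
    apply/critical_affine => //; have lq : l.[t] = l.[t] / (qform A).[t] * (qform A).[t].
      by rewrite divfK ?q_neq0.
    by split=> //; apply/critE; rewrite ?q_neq0 ?root_h.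
  have [s [t [s0 xE]]] := critical_generic gen cx.
  move: cx; rewrite xE => /(critical_affine _ _ s0)[lt l't].
  have qt : (qform A).[t] != 0.
    rewrite -rootE root_rho; apply/negP => rt.
    have := coprimep_root col rt; rewrite -/l lt.
    by move: rt; rewrite -root_rho => /eqP->; rewrite mulr0 eqxx.
  apply/mapP; exists t; first by rewrite -root_h; apply/(critE t s).
  by rewrite /phi lt mulfK.
rewrite -rs_size -(size_map phi); apply: card_eq_uniq_seq.
by rewrite map_inj_in_uniq.
Qed.

End CriticalPoints.

(** * The generic number of critical points *)

Lemma size_separable (K : numClosedFieldType) (p : {poly K}) (rs : seq K) :
    separable_poly p -> uniq rs -> (forall z, root p z = (z \in rs)) ->
  size p = (size rs).+1.
Proof.
move=> sep urs prs; have [ts pE] := closed_field_poly_normal p.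
have lp : lead_coef p != 0 by rewrite lead_coef_eq0 separable_poly_neq0.
have uts : uniq ts.
  by rewrite -separable_prod_XsubC -(eqp_separable (eqp_scale _ lp)) -pE.
rewrite pE size_scale // size_prod_XsubC; congr _.+1; apply/perm_size/uniq_perm => // z.
by rewrite -prs pE rootZ // root_prod_XsubC.
Qed.

Section GenericCount.
Variables (K : numClosedFieldType) (d0 r0 : nat).
Local Notation d := d0.+1.
Variable A : 'M[K]_d.+1.
Hypothesis A_sym : A^T = A.
Hypothesis A_unit : A \in unitmx.
Hypothesis A00 : A 0 0 != 0.

Lemma for_general_lform_separable :
  for_general (fun w : 'rV[K]_d.+1 => separable_poly (lform w)).
Proof.
have [w wE] : exists w : 'rV[K]_d.+1, lform w = 'X^d - 1.
  by apply: lform_surj; rewrite size_XnsubC.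
apply: for_generalW (for_general_separable (p := @lform K d) (u0 := w) (N := d.+1) _ _ _ _).
- by move=> u [].
- by [].
- by move=> u; apply: size_poly.
- by rewrite /= wE size_XnsubC.
by rewrite /= wE separable_Xn_sub_1 // pnatr_eq0.
Qed.

Lemma for_general_coprimep (p : {poly K}) : p != 0 ->
  for_general (fun w : 'rV[K]_d.+1 => coprimep p (lform w)).
Proof.
move=> p0; have [rs pE] := closed_field_poly_normal p.
have lp : lead_coef p != 0 by rewrite lead_coef_eq0.
apply: for_generalW (for_general_all (P := fun z w => (lform w).[z] != 0) rs _).
  move=> w /allP wrs; apply/Pdiv.ClosedField.coprimepP => z.
  by rewrite pE rootZ // root_prod_XsubC => /wrs.
move=> z; apply: for_generalW (for_general_linear (a := veronese d z 1 0) (j := ord_max) _).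
  by move=> w; rewrite horner_lform.
by rewrite mxE subnn expr0 expr1n mulr1 oner_neq0.
Qed.

Lemma for_general_infinity :
  for_general (fun w : 'rV[K]_d.+1 => w 0 0 * A 0 1 != w 0 1 * A 0 0).
Proof.
pose a (i : 'I_d.+1) := (i == 0)%:R * A 0 1 - (i == 1)%:R * A 0 0.
apply: for_generalW (for_general_linear (a := a) (j := 1) _) => [w|]; last first.
  by rewrite /a eqxx mul1r mul0r sub0r oppr_eq0.
rewrite (bigD1 0) //= (bigD1 1) //= big1 => [|i /andP[/negPf i0 /negPf i1]]; last first.
  by rewrite /a i0 i1 !mul0r subr0 mulr0.
rewrite /a !eqxx !mul0r !mul1r subr0 sub0r addr0 mulrN.
by rewrite subr_eq0.
Qed.

(** With [r0 + 1] distinct roots of [qform A], comparing degrees and leading coefficients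
of [q = rho g] and [q' = sigma g] provides what [for_general_hform] needs. *)
Lemma for_general_card_critical (rs : seq K) :
    uniq rs -> (forall z, root (qform A) z = (z \in rs)) ->
    size rs = r0.+1 -> (0 < r0)%N ->
  for_general (fun u => critical_points A u #= `I_(d0 + r0))%card.
Proof.
move=> urs qrs szrs r00; have szq := size_qform A00.
have q0 : qform A != 0 by rewrite -size_poly_gt0 szq.
have [rho [sigma [g [qE q'E cop sep rootq]]]] := radical_factorization q0.
have rho0 : rho != 0 by apply: separable_poly_neq0.
have g0 : g != 0 by apply: contraNneq q0 => g0; rewrite qE g0 mulr0.
have szrho : size rho = r0.+2.
  by rewrite (size_separable sep urs) ?szrs // => z; rewrite -rootq.
have szq' : size (qform A)^`() = (2 * d)%N by rewrite size_derivE szq.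
have q'0 : (qform A)^`() != 0 by rewrite -size_poly_gt0 szq'.
have sigma0 : sigma != 0 by apply: contraNneq q'0 => s0; rewrite q'E s0 mul0r.
have szsigma : size sigma = r0.+1.
  have := szq; have := szq'; rewrite q'E {1}qE !size_mul // szrho.
  have : (0 < size g)%N by rewrite size_poly_gt0.
  have : (0 < size sigma)%N by rewrite size_poly_gt0.
  move: (size sigma) (size g) => x y; lia.
have lead_sigma : lead_coef sigma = (2 * d)%:R * lead_coef rho.
  have := lead_coef_derivE (qform A); rewrite szq q'E {1}qE !lead_coefM /=.
  by rewrite -[_ *+ (2 * d)]mulr_natl mulrA => /mulIf; apply; rewrite lead_coef_eq0.
have gen : for_general (generic_functional A rho sigma (d0 + r0)).
  have := for_generalI (for_generalI (for_general_coprimep rho0) for_general_lform_separable)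
    (for_generalI for_general_infinity
      (for_general_hform szrho szsigma lead_sigma cop r00)).
  by apply: for_generalW => w [[? ?] [? ?]].
apply: for_generalW (for_general_mulmx A_unit gen) => u.
exact: (card_critical_points A_sym qE q'E cop rootq).
Qed.
End GenericCount.

(** * Real forms and conjugation of roots *)

Section RealForms.
Variables (R : realType) (d0 : nat).
Local Notation d := d0.+1.
Local Notation RC := (real_complex R).
Implicit Types (Q : {dot 'rV[R]_d.+1 for idfun}) (M : 'M[R]_d.+1).

Definition complex_mx Q : 'M[R[i]]_d.+1 := map_mx RC (matrix_of_form Q).

Lemma dot_formE Q v w : Q v w = dot (v *m matrix_of_form Q) w.
Proof. by rewrite -form_dot matrix_of_formK. Qed.

Lemma matrix_of_form_sym Q : (matrix_of_form Q)^T = matrix_of_form Q.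
Proof.
apply/matrixP => i j; rewrite !mxE.
by rewrite [LHS](hermitian_subproof (s := Q)) expr0 mul1r.
Qed.

Lemma complex_mx_sym Q : (complex_mx Q)^T = complex_mx Q.
Proof. by rewrite /complex_mx map_trmx matrix_of_form_sym. Qed.

Lemma complex_mx_unit Q : complex_mx Q \in unitmx.
Proof.
rewrite map_unitmx -row_free_unit; apply: inj_row_free => v vM.
apply/eqP/negPn/negP => /(neq0_dnorm_gt0 (s := Q)); rewrite dot_formE vM.
by rewrite /dot big1 ?ltxx // => i _; rewrite mxE mul0r.
Qed.

Lemma complex_mx00 Q : complex_mx Q 0 0 != 0.
Proof.
rewrite !mxE fmorph_eq0; apply: lt0r_neq0; apply: neq0_dnorm_gt0.
by apply/eqP => /rowP/(_ 0); rewrite !mxE !eqxx => /eqP; rewrite oner_eq0.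
Qed.

Lemma map_qform M : qform (map_mx RC M) = map_poly RC (qform M).
Proof.
rewrite /qform raddf_sum; apply: eq_bigr => i _ /=.
rewrite rmorphM /= map_polyXn; congr (_ * _).
apply/polyP => k; rewrite coef_map !coef_poly; by case: ifP => _; rewrite ?mxE ?rmorph0.
Qed.

Lemma qform_real_root Q (x : R) : ~~ root (qform (matrix_of_form Q)) x.
Proof.
rewrite rootE horner_qform -dot_formE; apply/lt0r_neq0/neq0_dnorm_gt0.
apply/eqP => /rowP/(_ ord_max); rewrite !mxE subnn expr0 expr1n mulr1 => /eqP.
by rewrite oner_eq0.
Qed.

Lemma qform_root_conj M (z : R[i]) :
  root (qform (map_mx RC M)) (conjc z) = root (qform (map_mx RC M)) z.
Proof.
set p := qform _.
have pE : p = map_poly (@conjc R) p.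
  rewrite /p map_qform -map_poly_comp; apply: eq_map_poly => x.
  by apply/esym; apply: conjc_real.
by rewrite -complex_root_conj -pE.
Qed.

(** Complex conjugation pairs the roots with positive imaginary part with those
with negative imaginary part, and there are no others. *)
Lemma conj_closed_even (s : seq R[i]) : uniq s ->
    (forall z, z \in s -> conjc z \in s) -> (forall x, RC x \notin s) ->
  size s = (2 * size [seq z <- s | (0 < complex.Im z)%R])%N.
Proof.
move=> us sC sR; have Im0 z : z \in s -> complex.Im z != 0.
  by case: z => a b zs /=; apply: contraTneq zs => ->; apply: sR.
rewrite size_filter -(count_predC (fun z => 0 < complex.Im z)) mul2n -addnn.
congr (_ + _)%N; rewrite -!size_filter -[in RHS](size_map conjc).
apply/esym/perm_size/uniq_perm.
- by rewrite map_inj_uniq ?filter_uniq //; apply: (can_inj (@conjcK R)).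
- by rewrite filter_uniq.
move=> z; rewrite mem_filter /=; apply/mapP/andP => [[y]|[zI zs]].
  rewrite mem_filter => /andP[yI ys] ->; split; last exact: sC.
  by move: yI; case: (y) => a b /=; rewrite oppr_gt0 -leNgt => /ltW.
exists (conjc z); last by rewrite conjcK.
rewrite mem_filter sC // andbT; have := Im0 z zs; move: zI; case: (z) => a b /=.
by rewrite -leNgt oppr_gt0 lt_neqAle => -> ->.
Qed.

Lemma EDdegreeE Q m :
    for_general (fun u => critical_points (complex_mx Q) u #= `I_m)%card ->
  Phi (rational_normal_curve R[i] d) Q = m.
Proof.
move=> gm; apply: xget_unique; first exact: gm.
move=> m' gm'; have [u [c c']] := for_general_ex (for_generalI gm gm').
apply/card_eq_II; apply: card_eq_trans c; rewrite card_eq_sym; exact: c'.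
Qed.

(** The number [r] of distinct roots is even and positive, say [r = 2 (k + 1)], so that
[d + r - 2 = d + 2 k]. *)
Lemma Phi_roots Q (rs : seq R[i]) : uniq rs ->
    (forall z, root (qform (complex_mx Q)) z = (z \in rs)) ->
  exists2 k, size rs = (2 * k.+1)%N &
    Phi (rational_normal_curve R[i] d) Q = (d + 2 * k)%N.
Proof.
move=> urs qrs; have sz := size_qform (complex_mx00 Q).
have [k sk] : exists k, size rs = (2 * k.+1)%N.
  have [z] : exists z, root (qform (complex_mx Q)) z.
    by apply/closed_rootP; rewrite sz.
  rewrite qrs => zrs; have : (0 < size rs)%N by case: (rs) zrs.
  have -> : (size rs = 2 * size [seq z <- rs | (0 < complex.Im z)%R])%N.
    apply: conj_closed_even => // [y|x]; first by rewrite -!qrs qform_root_conj.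
    by rewrite -qrs map_qform rootE horner_map fmorph_eq0; apply: qform_real_root.
  by case: (size _) => [|k] // _; exists k.
exists k => //; apply: EDdegreeE.
have := @for_general_card_critical _ d0 (2 * k).+1 _ (complex_mx_sym Q) (complex_mx_unit Q)
   (complex_mx00 Q) rs urs qrs.
rewrite addnS => h; apply: h => //; rewrite sk; lia.
Qed.
End RealForms.

(** * Values of the ED degree *)

Section DiagonalForms.
Variables (R : realType) (d0 : nat).
Local Notation d := d0.+1.
Local Notation RC := (real_complex R).

Lemma dot_form_exists n (M : 'M[R]_n) : M^T = M ->
    (forall u : 'rV[R]_n, u != 0 -> 0 < form_of_matrix idfun M u u) ->
  exists Q : {dot 'rV[R]_n for idfun}, matrix_of_form Q = M.
Proof.
move=> Msym Mpos; pose f : 'rV[R]_n -> 'rV[R]_n -> R := form_of_matrix idfun M.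
have herm x y : f x y = (-1) ^+ false * idfun (f y x).
  rewrite expr0 mul1r /f /form_of_matrix /= -mxtrace_tr !trmx_mul Msym mulmxA.
  by rewrite !map_mx_id ?trmxK.
pose Q : {dot 'rV[R]_n for idfun} := HB.pack f
  (bilinear_isBilinear.Build R _ _ _ _ _ f (form_of_matrix_is_bilinear 1 M idfun))
  (isHermitianSesquilinear.Build R 'rV[R]_n false idfun f herm)
  (isDotProduct.Build R 'rV[R]_n f Mpos).
by exists Q; apply: form_of_matrixK.
Qed.

Lemma dot_diag (c v w : 'rV[R]_d.+1) :
  dot (v *m diag_mx c) w = \sum_i v 0 i * c 0 i * w 0 i.
Proof. by rewrite mul_mx_diag; apply: eq_bigr => i _; rewrite !mxE. Qed.

Lemma dot_diag_exists (c : 'rV[R]_d.+1) : (forall i, 0 < c 0 i) ->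
  exists Q : {dot 'rV[R]_d.+1 for idfun}, matrix_of_form Q = diag_mx c.
Proof.
move=> c0; apply: dot_form_exists => [|u u0]; first exact: tr_diag_mx.
rewrite form_dot dot_diag lt_neqAle; apply/andP; split; last first.
  by apply: sumr_ge0 => i _; rewrite mulrAC mulr_ge0 ?(ltW (c0 i)) // -expr2 sqr_ge0.
apply: contraNneq u0 => /esym/eqP; rewrite psumr_eq0 => [/allP h|i _]; last first.
  by rewrite mulrAC mulr_ge0 ?(ltW (c0 i)) // -expr2 sqr_ge0.
apply/eqP/rowP => i; have := h i (mem_index_enum i); rewrite !mulf_eq0.
by rewrite (negPf (lt0r_neq0 (c0 i))) orbF orbb mxE => /eqP.
Qed.

Lemma horner_qform_diag (K : numFieldType) (P : {poly K}) t : (size P <= d.+1)%N ->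
  (qform (diag_mx (\row_(i < d.+1) P`_(d - i)))).[t] = P.[t ^+ 2].
Proof.
move=> sP; rewrite horner_qform mul_mx_diag (horner_coef_wide _ sP).
rewrite (reindex_inj rev_ord_inj); apply: eq_bigr => i _ /=.
by rewrite !mxE subSS expr1n !mulr1 -exprM mul2n -addnn exprD; ring.
Qed.

(** The coefficients of a product of factors [X + a] with [a > 0] are positive,
so these products give positive definite diagonal forms. *)
Lemma prod_XaddC_gt0 (s : seq R) : (forall a, a \in s -> 0 < a) ->
  let P := \prod_(a <- s) ('X + a%:P) in
  size P = (size s).+1 /\ forall i, (i <= size s)%N -> 0 < P`_i.
Proof.
elim: s => [|a s IH] s0 /=.
  by rewrite big_nil size_poly1; split=> // -[|//] _; rewrite coef1.
have [|szP P0] := IH; first by move=> b bs; rewrite s0 // inE bs orbT.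
have a0 : 0 < a by rewrite s0 // inE eqxx.
rewrite big_cons; set P := \prod_(b <- s) _ in szP P0 *.
have Pn0 : P != 0 by rewrite -size_poly_gt0 szP.
split.
  rewrite -[a]opprK polyCN size_proper_mul ?size_XsubC ?szP //.
  by rewrite lead_coefXsubC mul1r lead_coef_eq0.
move=> i; rewrite mulrDl coefD coefXM coefCM.
case: i => [|i] is_; first by rewrite add0r mulr_gt0 ?P0.
apply: ltr_wpDr; last exact: P0.
have [si|si] := ltnP i (size s); first by rewrite mulr_ge0 ?ltW // P0.
by rewrite nth_default ?mulr0 // szP.
Qed.

(** The form whose pullback is [(X^2 + 1)^(d - k) (X^2 + 2) ... (X^2 + k + 1)]; its roots
are the square roots of [-1, ..., -(k + 1)]. *)
Lemma Phi_surj k : (k < d)%N -> exists Q : {dot 'rV[R]_d.+1 for idfun},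
  Phi (rational_normal_curve R[i] d) Q = (d + 2 * k)%N.
Proof.
move=> kd; pose s : seq R := nseq (d - k.+1) 1 ++ [seq j.+1%:R | j <- iota 0 k.+1].
have s0 a : a \in s -> 0 < a.
  rewrite mem_cat => /orP[/nseqP[-> _]|/mapP[j _ ->]]; first exact: ltr01.
  by rewrite ltr0n.
have ss : size s = d by rewrite size_cat size_nseq size_map size_iota subnK.
have [szP P0] := prod_XaddC_gt0 s0; set P := \prod_(a <- s) _ in szP P0.
pose c := \row_(i < d.+1) P`_(d - i).
have [Q QE] : exists Q : {dot 'rV[R]_d.+1 for idfun}, matrix_of_form Q = diag_mx c.
  by apply: dot_diag_exists => i; rewrite mxE P0 // ss leq_subr.
exists Q; pose z j : R[i] := sqrtC (- j.+1%:R).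
have z2 j : z j ^+ 2 = - j.+1%:R by rewrite sqrtCK.
have z0 j : z j != 0 by rewrite sqrtC_eq0 oppr_eq0 pnatr_eq0.
pose rs := [seq z j | j <- iota 0 k.+1] ++ [seq - z j | j <- iota 0 k.+1].
have z_inj : injective z.
  move=> i j e; have := z2 i; rewrite e z2 => /oppr_inj/eqP.
  by rewrite eqr_nat => /eqP[].
have zN i j : z i != - z j.
  apply/eqP => e; have := z2 i; rewrite e sqrrN z2 => /oppr_inj/eqP.
  rewrite eqr_nat => /eqP[ij]; move/eqP: e; rewrite ij -addr_eq0 -mulr2n mulrn_eq0 /=.
  by rewrite (negPf (z0 i)).
have [] := @Phi_roots R d0 Q rs.
- rewrite cat_uniq !map_inj_uniq ?iota_uniq // ?andbT; last by move=> i j /oppr_inj/z_inj.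
  by apply/hasPn => _ /mapP[j _ ->]; apply/mapP => -[i _ /esym/eqP]; rewrite (negPf (zN _ _)).
- move=> x; rewrite /complex_mx QE /rs.
  have -> : map_mx RC (diag_mx c) = diag_mx (\row_(i < d.+1) (map_poly RC P)`_(d - i)).
    by rewrite map_diag_mx; congr diag_mx; apply/rowP => i; rewrite !mxE coef_map.
  rewrite rootE horner_qform_diag; last by rewrite size_map_poly szP ss.
  have -> : ((map_poly RC P).[x ^+ 2] == 0) = has (fun a => x ^+ 2 + RC a == 0) s.
    rewrite rmorph_prod horner_prod prodf_seq_eq0 /=; apply: eq_has => a.
    by rewrite rmorphD /= map_polyX map_polyC !hornerE.
  apply/hasP/idP => [[a as_]|].
    have {as_}[j jk ->] : exists2 j, (j < k.+1)%N & a = j.+1%:R.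
      move: as_; rewrite mem_cat => /orP[/nseqP[-> _]|/mapP[j]]; first by exists 0%N.
      by rewrite mem_iota add0n => jk ->; exists j.
    rewrite rmorph_nat -[_.+1%:R]opprK -z2 subr_eq0 eqf_sqr mem_cat.
    by case/orP=> /eqP->; apply/orP; [left|right]; apply/mapP; exists j; rewrite ?mem_iota.
  rewrite mem_cat => xz; have [j jk xj] : exists2 j, (j < k.+1)%N & x ^+ 2 = z j ^+ 2.
    by case/orP: xz => /mapP[j]; rewrite mem_iota => jk ->; exists j; rewrite ?sqrrN.
  exists j.+1%:R; last by rewrite xj z2 rmorph_nat addNr.
  by rewrite mem_cat; apply/orP; right; apply/mapP; exists j; rewrite ?mem_iota.
move=> k' sk' ->; move: sk'; rewrite size_cat !size_map size_iota => e.
by congr (_ + _)%N; lia.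
Qed.

Lemma Phi_values (Q : {dot 'rV[R]_d.+1 for idfun}) :
  exists2 k, (k < d)%N & Phi (rational_normal_curve R[i] d) Q = (d + 2 * k)%N.
Proof.
have sz := size_qform (complex_mx00 Q); set q := qform _ in sz.
have q0 : q != 0 by rewrite -size_poly_gt0 sz.
have [ts qE] := closed_field_poly_normal q.
have rq z : root q z = (z \in undup ts).
  by rewrite mem_undup qE rootZ ?lead_coef_eq0 // root_prod_XsubC.
have [k sk ->] := Phi_roots (undup_uniq ts) rq; exists k => //.
have := max_poly_roots q0 _ (undup_uniq ts); rewrite sk sz => h.
have /h : all (root q) (undup ts) by apply/allP => z; rewrite rq.
by lia.
Qed.
End DiagonalForms.

Theorem corollary5p10 (R : realType) (d : nat) (d_ge1 : (1 <= d)%N) :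
  range (Phi (rational_normal_curve R[i] d)) =
    [set m | exists2 k, (k < d)%N & m = (d + 2 * k)%N] /\
  (exists Q : {dot 'rV[R]_d.+1 for idfun},
      Phi (rational_normal_curve R[i] d) Q = d) /\
  (forall Q : {dot 'rV[R]_d.+1 for idfun},
      (d <= Phi (rational_normal_curve R[i] d) Q)%N).
Proof.
case: d d_ge1 => // d0 _; split; [|split].
- apply/seteqP; split=> [_ [Q _ <-]|_ [k kd ->]].
    by have [k kd ->] := Phi_values Q; exists k.
  by have [Q <-] := Phi_surj R kd; exists Q.
- by have [Q QE] := @Phi_surj R d0 0 isT; exists Q; rewrite QE muln0 addn0.
- by move=> Q; have [k _ ->] := Phi_values Q; rewrite leq_addr.
Qed.
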